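(* Let $L\colon[0,\infty)\to(0,\infty)$ be a non-decreasing function with $L(0)>0$ and $$\Lambda_L:=\sup_{s\ge 1}\frac{L(8s)^2}{L(2s)\,L(s)}<\infty .$$ Then for every set $D$, every reproducing kernel Hilbert space $\mathcal H_K$ of complex-valued functions on $D$ with bounded kernel $K$, and every $n\in\mathbb N$, one has $$\sup_{0\le k\le n} L(k)\, g_k^{\mathrm{lin}}(B_{\mathcal H_K})_\infty\ \le\ C_L\sup_{0\le k\le n} L(k)\, c_k(B_{\mathcal H_K})_\infty,\qquad C_L:=\max\bigl\{L(3)/L(0),\ 8\Lambda_L\bigr\},$$ where $k$ ranges over the integers $0,\dots,n$.
   Context: $B(D)$ is the space of bounded functions $D\to\mathbb C$ with norm $\|f\|_\infty=\sup_{x\in D}|f(x)|$. $\mathcal H_K$ is the reproducing kernel Hilbert space (RKHS) on $D$ with kernel $K\colon D\times D\to\mathbb C$, i.e. $f(x)=\langle f,K(\cdot,x)\rangle_{\mathcal H_K}$ for all $f\in\mathcal H_K$, $x\in D$. The kernel is bounded if $R:=\sup_{x\in D}\sqrt{K(x,x)}<\infty$; then $\mathcal H_K$ embeds continuously into $B(D)$. $B_{\mathcal H_K}$ is the unit ball of $\mathcal H_K$. Gelfand widths: for $n\ge1$, $$c_n(B_{\mathcal H_K})_\infty:=\inf_{\psi,N}\ \sup_{f\in B_{\mathcal H_K}}\|f-\psi(Nf)\|_\infty,$$ the infimum over all bounded linear maps $N\colon\mathcal H_K\to\mathbb C^n$ and all (arbitrary, possibly non-linear) maps $\psi\colon\mathbb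 C^n\to B(D)$. Linear sampling widths: for $m\ge1$, $$g_m^{\mathrm{lin}}(B_{\mathcal H_K})_\infty:=\inf_{x_1,\dots,x_m\in D,\ \varphi}\ \sup_{f\in B_{\mathcal H_K}}\|f-\varphi(f(x_1),\dots,f(x_m))\|_\infty,$$ the infimum over all points and all linear maps $\varphi\colon\mathbb C^m\to B(D)$. Convention: $g_0^{\mathrm{lin}}(B_{\mathcal H_K})_\infty=c_0(B_{\mathcal H_K})_\infty=\sup_{f\in B_{\mathcal H_K}}\|f\|_\infty=R$. *)

(* Defs.v *)
From HB Require Import structures.
From mathcomp Require Import all_boot all_order all_algebra.
From mathcomp Require Import complex.
From mathcomp Require Import all_classical all_reals all_analysis.

Set Implicit Arguments.
Unset Strict Implicit.
Unset Printing Implicit Defensive.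

Import Order.TTheory GRing.Theory Num.Theory.
Import numFieldNormedType.Exports.

Local Open Scope classical_set_scope.
Local Open Scope complex_scope.
Local Open Scope ring_scope.
Local Open Scope ereal_scope.

(* An element of the Hilbert space is identified with a function on D through
   the injective linear map [rkhs_fun]; [rkhs_sec x] is the element K(., x).
   The inner product is linear in its first argument. *)
Record rkhs (R : realType) (D : Type) (K : D -> D -> R[i]) := Rkhs {
  rkhs_space :> completeNormedModType R[i];
  rkhs_dot : {dot rkhs_space for Num.conj};
  rkhs_dotE : forall f : rkhs_space, rkhs_dot f f = (`|f| ^+ 2)%R;
  rkhs_fun : {linear rkhs_space -> (D -> R[i])};
  rkhs_fun_inj : injective rkhs_fun;
  rkhs_sec : D -> rkhs_space;
  rkhs_secE : forall x y : D, rkhs_fun (rkhs_sec x) y = K y x;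
  rkhs_reproducing : forall (f : rkhs_space) (x : D),
    rkhs_fun f x = rkhs_dot f (rkhs_sec x)
}.

(* On an empty D the two suprema below are -oo rather than 0. *)
Definition sup_norm (R : realType) (D : Type) (g : D -> R[i]) : \bar R :=
  ereal_sup [set (complex.Re `|g x|)%:E | x in [set: D]].

(* K x x is a nonnegative real number as soon as K has an RKHS. *)
Definition kernel_radius (R : realType) (D : Type) (K : D -> D -> R[i]) :
    \bar R :=
  ereal_sup [set (Num.sqrt (complex.Re (K x x)))%:E | x in [set: D]].

Definition bounded_functions (R : realType) (D : Type) : set (D -> R[i]) :=
  [set g | sup_norm g < +oo].

Section Widths.
Context (R : realType) (D : Type) (K : D -> D -> R[i]) (H : rkhs K).

Definition unit_ball : set H := [set f | (`|f| <= 1)%R].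

Definition worst_case_error (A : H -> D -> R[i]) : \bar R :=
  ereal_sup [set sup_norm (rkhs_fun H f - A f)%R | f in unit_ball].

Definition ball_radius : \bar R :=
  ereal_sup [set sup_norm (rkhs_fun H f) | f in unit_ball].

Definition bounded_linear (n : nat) : set {linear H -> 'rV[R[i]]_n} :=
  [set N | exists M : R[i], forall f : H, (`|N f| <= M * `|f|)%R].

Definition gelfand_width (n : nat) : \bar R :=
  if n is 0%N then ball_radius
  else ereal_inf [set worst_case_error (fun f => psi (N f)) |
         N in @bounded_linear n &
         psi in [set psi : 'rV[R[i]]_n -> D -> R[i] |
                  forall v, bounded_functions (psi v)]].

Definition lin_sampling_width (m : nat) : \bar R :=
  if m is 0%N then ball_radius
  else ereal_inf [set worst_case_error
                        (fun f => phi (\row_j rkhs_fun H f (x j))) |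
         x in [set: 'I_m -> D] &
         phi in [set phi : {linear 'rV[R[i]]_m -> (D -> R[i])} |
                  forall v, bounded_functions (phi v)]].

End Widths.

Definition Lambda (R : realType) (L : R -> R) : \bar R :=
  ereal_sup [set (L (8 * s) ^+ 2 / (L (2 * s) * L s))%:E | s in `[1%R, +oo[].

Definition C_const (R : realType) (L : R -> R) : \bar R :=
  maxe (L 3 / L 0)%:E (8%:E * Lambda L).

(* Main.v *)
(* Sampling at points x_1, ..., x_n recovers the unit ball up to the largest
   distance from a section K(., y) to span {K(., x_i)}. Choose the points
   greedily: x_(n+1) nearly maximizes the distance s_n to the first n sections.
   With e_i the Gram-Schmidt vectors of the chosen sections, the matrix of their
   coordinates along e_(p+1), ..., e_(2p) (p = 2m) is triangular, with diagonal
   at least s_(2p) / 2 and rows of norm at most s_p. An information map N of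
   rank m with error d forces the rows to have norm at most d on the kernel of
   N, which has dimension at least m. In an orthonormal basis adapted to this
   kernel, bounding the determinant by the arithmetic-geometric mean inequality
   gives s_(4m)^2 <= 8 s_(2m) d (the reduced-basis argument of DeVore, Petrova
   and Wojtaszczyk). The weighted comparison follows by strong induction on k
   with m = floor (k / 4), since 4m <= k <= 8m. *)
Require Import Defs.
From HB Require Import structures.
From mathcomp Require Import all_boot all_order all_algebra.
From mathcomp Require Import complex ring zify.
From mathcomp Require Import all_classical all_reals all_analysis.

Set Implicit Arguments.
Unset Strict Implicit.
Unset Printing Implicit Defensive.

Import Order.TTheory GRing.Theory Num.Theory.
Import numFieldNormedType.Exports.

Local Open Scope classical_set_scope.
Local Open Scope complex_scope.
Local Open Scope ring_scope.

(** * Determinant estimates from the arithmetic-geometric mean inequality *)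

Section Determinant.
Local Open Scope sesquilinear_scope.
Context {C : numClosedFieldType}.

Lemma dotmx_sum n (u : 'rV[C]_n) : dotmx u u = \sum_j `|u 0 j| ^+ 2.
Proof. by rewrite dotmxE mxE; apply: eq_bigr => j _; rewrite !mxE normCK. Qed.

Lemma mxtrace_mul_conj m n (X : 'M[C]_(m, n)) :
  \tr (X *m X ^t*) = \sum_i dotmx (row i X) (row i X).
Proof.
apply: eq_bigr => i _; rewrite dotmx_sum mxE.
by apply: eq_bigr => j _; rewrite !mxE normCK.
Qed.

(** Unitary triangularization keeps the determinant and the Frobenius norm. The AGM inequality then
    applies to the squared moduli of the diagonal entries, whose sum is at most the squared
    Frobenius norm. *)
Lemma det_AGM n (X : 'M[C]_n) :
  `|\det X| ^+ 2 * n%:R ^+ n <= \tr (X *m X ^t*) ^+ n.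
Proof.
case: n X => [|n] X; first by rewrite !expr0 det_mx00 normr1 expr1n mulr1.
have [P Pu] := spectral.Schur X (ltn0Sn n).
have Punit := unitarymx_unit Pu.
rewrite /similar_to conjymx // => /is_trig_mxP Ttrig.
set T := P *m X *m P^t* in Ttrig.
have detT : \det T = \det X.
  rewrite /T -invmx_unitary // !det_mulmx mulrC mulrA -det_mulmx mulVmx //.
  by rewrite det1 mul1r.
have trT : \tr (T *m T ^t*) = \tr (X *m X ^t*).
  rewrite /T !trmx_mul !map_mxM trmxCK !mulmxA -[_ *m _ *m P^t* *m P]mulmxA.
  rewrite -[P^t*]invmx_unitary // mulVmx // mulmx1 -!mulmxA mxtrace_mulC.
  by rewrite -!mulmxA mulVmx // mulmx1.
rewrite -detT -trT det_trig; last by apply/is_trig_mxP.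
rewrite normr_prod -prodrXl.
have /leif_AGM_scaled := fun i (_ : i \in 'I_n.+1) =>
  mulrn_wge0 #|'I_n.+1| (exprn_ge0 2 (normr_ge0 (T i i))).
case=> /= + _; under eq_bigr do rewrite -mulr_natr.
rewrite big_split /= prodr_const card_ord => /le_trans; apply.
have trT_ge0 : 0 <= \tr (T *m T ^t*).
  by rewrite mxtrace_mul_conj sumr_ge0 // => i _; rewrite dnorm_ge0.
apply: lerXn2r; rewrite ?nnegrE //.
  by apply: sumr_ge0 => i _; rewrite exprn_ge0.
rewrite mxtrace_mul_conj ler_sum // => i _.
rewrite dotmx_sum (bigD1 i) //= [row i T 0 i]mxE lerDl.
by apply: sumr_ge0 => j _; rewrite exprn_ge0.
Qed.

(** By rank-nullity the left kernel of [B] contains [m] independent rows; orthonormalizing them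
    first makes them span the upper block. *)
Lemma exists_unitary_ker m p (B : 'M[C]_(m + p, p)) :
  exists2 U : 'M[C]_(m + p), U \is unitarymx & usubmx U *m B = 0.
Proof.
have rk : (m <= \rank (kermx B))%N.
  by rewrite mxrank_ker leq_subRL ?rank_leq_row // addnC leq_add2l rank_leq_col.
pose V : 'M[C]_(m, m + p) := pid_mx m *m row_base (kermx B).
have rkV : \rank V = m by rewrite mxrankMfree ?row_base_free // rank_pid_mx.
have VB : V *m B = 0.
  apply/sub_kermxP; apply: submx_trans (submxMl _ _) _.
  by rewrite eq_row_base.
(* The zero rows leave room for completing the kernel vectors to a full orthonormal basis. *)
pose S := schmidt (col_mx V 0 : 'M[C]_(m + p)).
exists S; first exact: schmidt_unitarymx.
have sVS : (V <= usubmx S)%MS.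
  apply/row_subP => i.
  have := row_schmidt_sub (col_mx V 0 : 'M[C]_(m + p)) (lshift p i).
  rewrite rowKu => /submx_trans; apply; apply/sumsmx_subP => k /= leki.
  have ltkm : (k < m)%N by apply: leq_ltn_trans leki (ltn_ord i).
  rewrite genmxE (_ : k = lshift p (Ordinal ltkm)); last exact/val_inj.
  by rewrite -row_usubmx row_sub.
have sSV : (usubmx S <= V)%MS.
  by rewrite -(mxrank_leqif_sup sVS) rkV eqn_leq rank_leq_row -{1}rkV mxrankS.
by apply/sub_kermxP; apply: submx_trans sSV _; apply/sub_kermxP.
Qed.

(** In a unitary basis adapted to the kernel of [B], each row of [G] has a kernel part of norm at
    most [d] and a complementary part of norm at most [s]. The diagonal bounds the determinant from
    below, and [det_AGM] bounds it from above. *)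
Lemma trig_diag_le_ker m (G : 'M[C]_(m + m)) (B : 'M[C]_(m + m, m))
    (a s d : C) :
    (0 < m)%N -> 0 <= a -> 0 < s -> 0 < d -> is_trig_mx G ->
    (forall i, a <= `|G i i|) ->
    (forall i, dotmx (row i G) (row i G) <= s ^+ 2) ->
    (forall i c, c *m B = 0 ->
       `|dotmx c (row i G)| ^+ 2 <= d ^+ 2 * dotmx c c) ->
  a ^+ 2 <= 2 * s * d.
Proof.
move=> m_gt0 a_ge0 s_gt0 d_gt0 Gtrig Ga Gs Gd.
have [U Uu UB] := exists_unitary_ker B.
(* Rescaling the two blocks makes both contribute (s * d)^2 to the row norms. *)
pose X := G *m U^t* *m block_mx s%:M 0 0 d%:M.
have sd_ge0 : 0 <= s * d by rewrite mulr_ge0 // ltW.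
have XE : X = row_mx (s *: (G *m (usubmx U)^t*)) (d *: (G *m (dsubmx U)^t*)).
  rewrite /X -{1}[U]vsubmxK tr_col_mx map_row_mx mul_mx_row mul_row_block.
  by rewrite !mulmx0 addr0 add0r !mul_mx_scalar.
have detX : `|\det X| = `|\det G| * (s * d) ^+ m.
  rewrite /X !det_mulmx det_ublock !det_scalar !normrM exprMn.
  rewrite !normrX !(gtr0_norm s_gt0) !(gtr0_norm d_gt0).
  suff -> : `|\det (U ^t*)| = 1 by rewrite mulr1.
  rewrite det_map_mx norm_conjC det_tr; apply/eqP.
  rewrite -(@pexpr_eq1 _ _ 2) // normCK -[X in _ * X^*]det_tr.
  by rewrite -det_map_mx -det_mulmx (unitarymxP _) ?det1.
have U1u : usubmx U \is unitarymx.
  apply/row_unitarymxP => i j; rewrite !row_usubmx (row_unitarymxP _) //.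
have dotX i : dotmx (row i X) (row i X) <= 2 * (s * d) ^+ 2.
  set g := row i G; set u := g *m (usubmx U)^t*; set v := g *m (dsubmx U)^t*.
  have gE : dotmx g g = dotmx u u + dotmx v v.
    have uvE : row_mx u v = g *m U^t*.
      by rewrite -[U in RHS]vsubmxK tr_col_mx map_row_mx mul_mx_row.
    transitivity (dotmx (row_mx u v) (row_mx u v)).
      by rewrite uvE !dotmxE trmx_mul map_mxM trmxCK mulmxA mulmxKtV.
    by rewrite !dotmxE tr_row_mx map_col_mx mul_row_col mxE.
  have u_ge0 : 0 <= dotmx u u by rewrite dnorm_ge0.
  have v_ge0 : 0 <= dotmx v v by rewrite dnorm_ge0.
  have -> : dotmx (row i X) (row i X) = s ^+ 2 * dotmx u u + d ^+ 2 * dotmx v v.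
    have -> : row i X = row_mx (s *: u) (d *: v).
      by rewrite XE row_row_mx !linearZ /= !row_mul.
    rewrite dotmxE tr_row_mx map_col_mx mul_row_col mxE -!dotmxE !dnormZ.
    by rewrite !gtr0_norm.
  (* Testing [Gd] with the projection of the row onto the kernel gives
     [(dotmx u u)^2 <= d^2 * dotmx u u]. *)
  have u_le : dotmx u u <= d ^+ 2.
    have := Gd i (u *m usubmx U).
    have -> : dotmx (u *m usubmx U) (row i G) = dotmx u u.
      by rewrite !dotmxE [in RHS]trmx_mul map_mxM trmxCK mulmxA.
    have -> : dotmx (u *m usubmx U) (u *m usubmx U) = dotmx u u.
      by rewrite !dotmxE trmx_mul map_mxM mulmxA mulmxtVK.
    rewrite -mulmxA UB mulmx0 ger0_norm // => /(_ erefl).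
    have [-> _|u_neq0] := eqVneq (dotmx u u) 0; first by rewrite exprn_ge0 ?ltW.
    by rewrite expr2 ler_pM2r // lt_def u_neq0.
  have v_le : dotmx v v <= s ^+ 2.
    by apply: le_trans (Gs i); rewrite -/g gE lerDr.
  rewrite mulr_natl mulr2n exprMn; apply: lerD.
    by rewrite ler_wpM2l // exprn_ge0 // ltW.
  by rewrite mulrC ler_wpM2r // exprn_ge0 // ltW.
have sd_gt0 : 0 < s * d by rewrite mulr_gt0.
have m2_gt0 : 0 < (m + m)%:R :> C by rewrite ltr0n addn_gt0 m_gt0.
have detG : a ^+ (m + m) <= `|\det G|.
  rewrite det_trig // normr_prod -[X in a ^+ X]card_ord -prodr_const.
  by apply: ler_prod => i _; rewrite a_ge0 Ga.
have trX : \tr (X *m X ^t*) <= (m + m)%:R * (2 * (s * d) ^+ 2).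
  rewrite mxtrace_mul_conj mulr_natl -[X in _ *+ X]card_ord -sumr_const.
  by apply: ler_sum => i _.
(* [|det X|] is at least [a^(2m) (s d)^m], so both sides become powers of exponent 2m; taking roots
   and cancelling [2m] and [s * d] leaves the claim. *)
have key : (a ^+ 2 * (s * d) * (m + m)%:R) ^+ (m + m)
    <= ((m + m)%:R * (2 * (s * d) ^+ 2)) ^+ (m + m).
  apply: (@le_trans _ _ (\tr (X *m X ^t*) ^+ (m + m))); last first.
    apply: lerXn2r trX; rewrite nnegrE.
      by rewrite mxtrace_mul_conj sumr_ge0 // => i _; rewrite dnorm_ge0.
    by rewrite mulr_ge0 ?(ltW m2_gt0) // mulr_ge0 // exprn_ge0.
  apply: le_trans (det_AGM X); rewrite exprMn ler_wpM2r ?exprn_ge0 //.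
  rewrite detX; move: (s * d) sd_ge0 => e e_ge0.
  rewrite exprMn exprAC exprMn -[(_ ^+ m) ^+ 2]exprM muln2 -addnn.
  rewrite ler_wpM2r ?exprn_ge0 //.
  by apply: lerXn2r detG; rewrite nnegrE ?exprn_ge0.
rewrite ler_pXn2r ?nnegrE ?mulr_ge0 ?exprn_ge0 ?addn_gt0 ?m_gt0
  ?(ltW s_gt0) ?(ltW d_gt0) // in key.
move: key; rewrite mulrC ler_pM2l // (_ : 2 * _ = 2 * s * d * (s * d)).
  by rewrite ler_pM2r.
by rewrite expr2 !mulrA.
Qed.
End Determinant.

(** * Gram-Schmidt for sequences that may be linearly dependent *)

Section GramSchmidt.
Context {C : numClosedFieldType} {U : lmodType C} (dot : {dot U for Num.conj}).
Implicit Types (e g : nat -> U) (v : U).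

Local Notation "''[' u , v ]" := (dot u v) : ring_scope.
Local Notation "''[' u ]" := '[u, u] : ring_scope.

Definition residual e n v : U := v - \sum_(i < n) '[v, e i] *: e i.

Definition normalize v : U := (sqrtC '[v])^-1 *: v.

(* A vanishing residual yields the zero vector, because [0^-1 = 0]. *)
Definition gram_schmidt g e := forall n, e n = normalize (residual e n (g n)).

Definition in_span g n v := exists a : 'I_n -> C, v = \sum_i a i *: g i.

Lemma dot_normalize v w : '[v, normalize w] = (sqrtC '[w])^-1 * '[v, w].
Proof.
by rewrite linearZr_LR /= conj_Creal // realV ger0_real // sqrtC_ge0 dnorm_ge0.
Qed.

Lemma dot_self_normalize v : '[v, normalize v] = sqrtC '[v].
Proof.
rewrite dot_normalize; have [->|v_neq0] := eqVneq v 0.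
  by rewrite linear0r mulr0 sqrtC0.
by rewrite -[X in _ * X]sqrtCK expr2 mulKf // sqrtC_eq0 dnorm_eq0.
Qed.

Lemma dnorm_normalize v : '[normalize v] = (normalize v != 0)%:R.
Proof.
rewrite {2}/normalize; have [->|v_neq0] := eqVneq v 0.
  by rewrite /normalize scaler0 linear0r eqxx.
rewrite scaler_eq0 negb_or invr_eq0 sqrtC_eq0 dnorm_eq0 v_neq0 /=.
rewrite dot_normalize linearZl_LR /= mulrA -expr2 exprVn sqrtCK mulVf //.
by rewrite dnorm_eq0.
Qed.

Lemma residualS e n v :
  residual e n.+1 v = residual e n v - '[v, e n] *: e n.
Proof. by rewrite /residual big_ord_recr opprD addrA. Qed.

Lemma in_span_lin g n a v w :
  in_span g n v -> in_span g n w -> in_span g n (a *: v + w).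
Proof.
move=> [b ->] [c ->]; exists (fun i => a * b i + c i).
rewrite scaler_sumr -big_split /=; apply: eq_bigr => i _.
by rewrite scalerDl scalerA.
Qed.

Lemma in_span0 g n : in_span g n 0.
Proof. by exists (fun=> 0); rewrite big1 // => i _; rewrite scale0r. Qed.

Lemma in_span_gen g n i : (i < n)%N -> in_span g n (g i).
Proof.
move=> i_lt; exists (fun j => (j == Ordinal i_lt)%:R).
rewrite (bigD1 (Ordinal i_lt)) //= eqxx scale1r big1 ?addr0 // => j /negPf ->.
by rewrite scale0r.
Qed.

Section Family.
Context (g e : nat -> U) (gse : gram_schmidt g e).

Lemma dnorm_gs n : '[e n] = (e n != 0)%:R.
Proof. by rewrite gse dnorm_normalize. Qed.

(** The squared norm of [e n] is 1, or else [e n] is 0 and both sides vanish. This lets later proofs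
    avoid splitting off the degenerate case. *)
Lemma dot_gs_id v n : '[v, e n] * '[e n] = '[v, e n].
Proof.
rewrite dnorm_gs; have [->|] := eqVneq (e n) 0; last by rewrite mulr1.
by rewrite !linear0r.
Qed.

(** The induction hypothesis makes the earlier vectors pairwise orthogonal, each being a multiple of
    a residual; only the term of index [i] then survives in the projection. *)
Lemma dot_residual_gs_lt n v i : (i < n)%N -> '[residual e n v, e i] = 0.
Proof.
elim/ltn_ind: n v i => n IHn v i i_lt.
have orth (j k : 'I_n) : j != k -> '[e j, e k] = 0.
  wlog lt_kj : j k / (k < j)%N.
    move=> wlog_lt jk; have [lt|lt|/val_inj eq_jk] := ltngtP k j.
    - exact: wlog_lt.
    - apply/eqP; rewrite herm_eq0C; apply/eqP.
      by apply: wlog_lt => //; rewrite eq_sym.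
    - by rewrite eq_jk eqxx in jk.
  by move=> _; rewrite gse linearZl_LR /= IHn ?mulr0.
rewrite /residual linearBl /= linear_sumlz /= (bigD1 (Ordinal i_lt)) //=.
rewrite linearZl_LR /= dot_gs_id big1 ?addr0 ?subrr // => j ji.
by rewrite linearZl_LR /= (orth j (Ordinal i_lt)) // mulr0.
Qed.

Lemma dot_gs_lt i n : (i < n)%N -> '[e i, e n] = 0.
Proof.
move=> i_lt; apply/eqP; rewrite herm_eq0C [e n]gse linearZl_LR /=.
by rewrite dot_residual_gs_lt ?mulr0.
Qed.

Lemma dot_gs_neq i n : i != n -> '[e i, e n] = 0.
Proof.
case: ltngtP => // lt_in _; first exact: dot_gs_lt.
by apply/eqP; rewrite herm_eq0C; apply/eqP/dot_gs_lt.
Qed.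

Lemma dot_residual_gs n v : '[residual e n v, e n] = '[v, e n].
Proof.
rewrite /residual linearBl /= linear_sumlz /= big1 ?subr0 // => i _.
by rewrite linearZl_LR /= dot_gs_lt ?mulr0.
Qed.

(** Pythagoras, valid also when [e n] vanishes. *)
Lemma dnorm_residualS n v :
  '[residual e n.+1 v] = '[residual e n v] - `|'[v, e n]| ^+ 2.
Proof.
rewrite residualS -(dot_residual_gs n v); set w := residual e n v.
rewrite dnormB dnormZ linearZr_LR /= [_^* * _]mulrC -normCK.
rewrite (conj_Creal (ger0_real _)) ?exprn_ge0 // opprD addrA.
suff -> : `|'[w, e n]| ^+ 2 * '[e n] = `|'[w, e n]| ^+ 2 by rewrite addrK.
by rewrite normCK mulrAC dot_gs_id.
Qed.

(** Telescoping Pythagoras; it bounds a block of coordinates of [v] by its residual at [p]. *)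
Lemma dnorm_residual_split p n v :
  '[residual e p v] =
  '[residual e (p + n) v] + \sum_(i < n) `|'[v, e (p + i)%N]| ^+ 2.
Proof.
elim: n => [|n IHn]; first by rewrite big_ord0 addr0 addn0.
rewrite IHn addnS dnorm_residualS big_ord_recr /= [X in _ = _ - _ + X]addrC.
by rewrite addrA subrK.
Qed.

Lemma dnorm_residual_le p n v :
  (p <= n)%N -> '[residual e n v] <= '[residual e p v].
Proof.
move=> /subnKC <-; rewrite (dnorm_residual_split p (n - p)) lerDl.
by apply: sumr_ge0 => i _; rewrite exprn_ge0.
Qed.

(** By monotonicity [p = n + 1] suffices, and there the coordinate along [e n] carries the whole
    norm of the residual of [g n]. *)
Lemma residual_gen n p : (n < p)%N -> residual e p (g n) = 0.
Proof.
move=> lt_np; apply/eqP; rewrite -(dnorm_eq0 dot) eq_le dnorm_ge0 andbT.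
apply: le_trans (dnorm_residual_le _ lt_np) _.
rewrite dnorm_residualS -dot_residual_gs [e n]gse dot_self_normalize normCK.
by rewrite conj_Creal ?ger0_real ?sqrtC_ge0 ?dnorm_ge0 // -expr2 sqrtCK subrr.
Qed.

Lemma dot_gen_gs n : '[g n, e n] = sqrtC '[residual e n (g n)].
Proof. by rewrite -dot_residual_gs [e n]gse dot_self_normalize. Qed.

(** The source of triangularity for the coordinate matrix. *)
Lemma dot_gen_gs_gt n p : (n < p)%N -> '[g n, e p] = 0.
Proof. by move=> lt_np; rewrite -dot_residual_gs residual_gen // linear0l. Qed.

(** Only an inequality, since vanishing [e (p + i)] contribute nothing on the left. *)
Lemma dnorm_comb p n (c : 'I_n -> C) :
  '[\sum_i c i *: e (p + i)%N] <= \sum_i `|c i| ^+ 2.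
Proof.
rewrite linear_sumlz /=; apply: ler_sum => i _.
rewrite linearZl_LR /= linear_sumr (bigD1 i) //= linearZr_LR /= big1 ?addr0.
  rewrite mulrA -normCK dnorm_gs -[leRHS]mulr1 ler_wpM2l ?exprn_ge0 //.
  by rewrite lern1; case: (_ != _).
move=> j ji; rewrite linearZr_LR /= dot_gs_neq ?mulr0 //.
by rewrite eqn_add2l eq_sym.
Qed.

Lemma gs_in_span n p : (n < p)%N -> in_span g p (e n).
Proof.
elim/ltn_ind: n => n IHn lt_np.
rewrite gse /normalize -[_ *: _]addr0; apply: in_span_lin; last exact: in_span0.
rewrite /residual addrC -scaleN1r; apply: in_span_lin; last exact: in_span_gen.
elim/big_ind: _ => [|v w vS wS|i _]; first exact: in_span0.
  by rewrite -[v]scale1r; apply: in_span_lin.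
rewrite -[_ *: _]addr0; apply: in_span_lin; last exact: in_span0.
by apply: IHn => //; apply: ltn_trans lt_np.
Qed.

End Family.
End GramSchmidt.

(** * Near-maximizers and recursive selection of points *)

Section Selection.

(** The supremum may not be attained, but a positive one is exceeded by twice some value; if it is
    0, any point will do. *)
Lemma exists_half_max (R : realType) (T : Type) (f : T -> R) (M : R) :
    inhabited T -> (forall y, 0 <= f y) -> (forall y, f y <= M) ->
  exists x, forall y, f y <= 2 * f x.
Proof.
move=> [x0] f_ge0 fM; set S := range f.
have supS : has_sup S.
  by split; [exists (f x0), x0|exists M => _ [y _ <-]].
have f_le y : f y <= sup S by apply: sup_upper_bound => //; exists y.
have [S_le0|S_gt0] := leP (sup S) 0.
  exists x0 => y; apply: le_trans (f_le y) (le_trans S_le0 _).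
  by rewrite mulr_ge0.
have [_ [x _ <-] fx] := sup_adherent (divr_gt0 S_gt0 (ltr0Sn _ 1)) supS.
exists x => y; apply: le_trans (f_le y) _; rewrite -ler_pdivrMl // mulrC.
by apply: ltW; move: fx; rewrite {1}[sup S]splitr addrK.
Qed.

(** The criterion [Q] for the next point sees only the residual map of the vectors already built, so
    points and vectors can be constructed together. *)
Lemma exists_gram_schmidt (C : numClosedFieldType) (U : lmodType C)
    (dot : {dot U for Num.conj}) (T : Type) (k : T -> U)
    (Q : (U -> U) -> T -> Prop) :
    (forall e n, exists x, Q (residual dot e n) x) ->
  exists x e, gram_schmidt dot (k \o x) e /\
    forall n, Q (residual dot e n) (x n).
Proof.
move=> exQ; pose next e n := projT1 (cid (exQ e n)).
have nextQ e n : Q (residual dot e n) (next e n) := projT2 (cid (exQ e n)).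
(* [st n] holds the first [n] vectors, padded with zeros; the sequence [e] is read off the
   diagonal. *)
pose st := fix st n : nat -> U :=
  if n is n'.+1 then fun i =>
    if i == n' then
      normalize dot (residual dot (st n') n' (k (next (st n') n')))
    else st n' i
  else fun=> 0.
pose e n := st n.+1 n.
have stE n i : (i < n)%N -> st n i = e i.
  elim: n => // n IHn; rewrite ltnS leq_eqVlt => /predU1P[->//|lt_in].
  by rewrite /= ltn_eqF ?IHn.
have resE n : residual dot (st n) n = residual dot e n.
  apply/funext => v; rewrite /residual; congr (_ - _).
  by apply: eq_bigr => i _; rewrite stE.
exists (fun n => next (st n) n), e; split=> n; last by rewrite -resE.
by rewrite {1}/e /= eqxx resE.
Qed.

End Selection.

(** * Greedy points in the RKHS and their relation to both widths *)

Section Widths.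
Context (R : realType) (D : Type) (K : D -> D -> R[i]) (H : rkhs K).

Local Notation dot := (rkhs_dot H).
Local Notation k := (rkhs_sec H).
Local Notation C := R[i].

Lemma complex_Re_norm (V : normedZmodType C) (v : V) :
  (complex.Re `|v|)%:C = `|v|.
Proof. by rewrite RRe_real // normr_real. Qed.

Lemma sqrt_dnorm (v : H) : sqrtC (dot v v) = `|v|.
Proof. by rewrite rkhs_dotE sqrCK. Qed.

(** Expand the nonnegative squared norm of [dot w w *: v - dot v w *: w] and divide by [dot w w]. *)
Lemma dot_CauchySchwarz (v w : H) : `|dot v w| <= `|v| * `|w|.
Proof.
rewrite -ler_sqr ?nnegrE ?mulr_ge0 // exprMn -!rkhs_dotE.
have [->|w_neq0] := eqVneq w 0; first by rewrite !linear0r normr0 expr0n.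
have w_gt0 : 0 < dot w w by rewrite dnorm_gt0.
have := dnorm_ge0 dot (dot w w *: v - dot v w *: w).
rewrite dnormB !dnormZ linearZl_LR linearZr_LR /= ger0_norm ?(ltW w_gt0) //.
rewrite [_^* * _]mulrC -normCK conj_Creal; last first.
  by rewrite ger0_real // mulr_ge0 ?exprn_ge0 // ltW.
set a := dot w w in w_gt0 *; set b := dot v v; set c := `|_| ^+ 2.
rewrite (_ : _ + _ = a * (b * a - c)); last by ring.
by rewrite pmulr_rge0 // subr_ge0.
Qed.

Lemma norm_rkhs_fun_le (f : H) y : `|rkhs_fun H f y| <= `|f| * `|k y|.
Proof. by rewrite rkhs_reproducing dot_CauchySchwarz. Qed.

Lemma kernel_bound : (kernel_radius K < +oo)%E ->
  exists M : R, forall y, complex.Re `|k y| <= M.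
Proof.
move=> Kfin.
have kE y : Num.sqrt (complex.Re (K y y)) = complex.Re `|k y|.
  have -> : K y y = ((complex.Re `|k y|) ^+ 2)%:C.
    rewrite rmorphXn /= complex_Re_norm -rkhs_dotE -rkhs_reproducing.
    by rewrite rkhs_secE.
  by rewrite /= sqrtr_sqr ger0_norm // -ler0c complex_Re_norm.
have Kub y : ((complex.Re `|k y|)%:E <= kernel_radius K)%E.
  by rewrite -kE; apply: ereal_sup_ubound; exists y.
move: Kfin Kub; case: (kernel_radius K) => [r| |] Kfin Kub.
- by exists r => y; rewrite -lee_fin.
- by rewrite ltxx in Kfin.
- by exists 0 => y; have := Kub y.
Qed.

Section GreedyBasis.
Context (D_nonempty : inhabited D) (K_bounded : (kernel_radius K < +oo)%E).
Context (x : nat -> D) (e : nat -> H).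
Context (gse : gram_schmidt dot (k \o x) e).

Local Notation res := (residual dot e).

(** The distance s_n: [res n (k y)] is the component of K(., y) orthogonal to the first [n] chosen
    sections. *)
Definition greedy_error n : R :=
  sup (range (fun y => complex.Re `|res n (k y)|)).

Lemma norm_residual_le p n (v : H) : (p <= n)%N -> `|res n v| <= `|res p v|.
Proof.
move=> le_pn; rewrite -!sqrt_dnorm ler_sqrtC ?nnegrE ?dnorm_ge0 //.
exact: dnorm_residual_le gse _ _ _ le_pn.
Qed.

Lemma residual0 v : res 0 v = v.
Proof. by rewrite /residual big_ord0 subr0. Qed.

Lemma Re_norm_le (V W : normedZmodType C) (v : V) (w : W) :
  (complex.Re `|v| <= complex.Re `|w|) = (`|v| <= `|w|).
Proof. by rewrite -lecR !complex_Re_norm. Qed.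

Lemma norm_residual_le_greedy n y : complex.Re `|res n (k y)| <= greedy_error n.
Proof.
have [M kM] := kernel_bound K_bounded.
apply: sup_upper_bound; last by exists y.
case: D_nonempty => y0; split; first by exists (complex.Re `|res n (k y0)|), y0.
exists M => _ [z _ <-]; apply: le_trans (kM z).
by rewrite Re_norm_le -{2}[k z]residual0 norm_residual_le.
Qed.

Lemma greedy_error_le n c :
  (forall y, complex.Re `|res n (k y)| <= c) -> greedy_error n <= c.
Proof.
move=> res_le; case: D_nonempty => y0.
by apply: ge_sup => [|_ [y _ <-] //]; exists (complex.Re `|res n (k y0)|), y0.
Qed.

Lemma greedy_error_ge0 n : 0 <= greedy_error n.
Proof.
case: D_nonempty => y0; apply: le_trans (norm_residual_le_greedy n y0).
by rewrite -ler0c complex_Re_norm.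
Qed.

Lemma greedy_error_decr p n : (p <= n)%N -> greedy_error n <= greedy_error p.
Proof.
move=> le_pn; apply: greedy_error_le => y.
apply: le_trans (norm_residual_le_greedy p y).
by rewrite Re_norm_le norm_residual_le.
Qed.

Context (x_max : forall n y,
  complex.Re `|res n (k y)| <= 2 * complex.Re `|res n (k (x n))|).

Lemma greedy_error_le_max n : (greedy_error n)%:C / 2 <= `|res n (k (x n))|.
Proof.
rewrite ler_pdivrMr // mulrC -complex_Re_norm.
rewrite -[2](rmorph_nat (real_complex R)) -rmorphM lecR.
by apply: greedy_error_le => y; apply: x_max.
Qed.

(** [trig_diag_le_ker] is used with [a] half of s_(2p) and [s] equal to s_p. The constant 8 is its
    factor 2 times the 4 from squaring the half. *)
Lemma greedy_error_double m (N : {linear H -> 'rV[C]_m}) (d : R) :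
    (0 < m)%N -> 0 < d ->
    (forall f y, N f = 0 -> `|rkhs_fun H f y| <= d%:C * `|f|) ->
  greedy_error (m + m + (m + m)) ^+ 2 <= 8 * greedy_error (m + m) * d.
Proof.
move=> m_gt0 d_gt0 N_le; set p := (m + m)%N.
(* The determinant bound needs s_p > 0; if s_p = 0, monotonicity gives s_(2p) = 0. *)
have [s_gt0|] := ltP 0 (greedy_error p); last first.
  move=> s_le0; have s_eq0 : greedy_error p = 0.
    by apply/eqP; rewrite eq_le s_le0 greedy_error_ge0.
  have: greedy_error (p + p) <= 0.
    by rewrite -s_eq0 greedy_error_decr // leq_addl.
  rewrite s_eq0 mulr0 mul0r => le0.
  have -> : greedy_error (p + p) = 0.
    by apply/eqP; rewrite eq_le le0 greedy_error_ge0.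
  by rewrite expr0n.
pose G : 'M[C]_p := \matrix_(i, j) dot (k (x (p + i)%N)) (e (p + j)%N).
pose B : 'M[C]_(p, m) := \matrix_(i, l) N (e (p + i)%N) 0 l.
have le_sq : ((greedy_error (p + p))%:C / 2) ^+ 2
    <= 2 * (greedy_error p)%:C * d%:C.
  apply: (@trig_diag_le_ker _ m G B) => //.
  - by rewrite divr_ge0 // ler0c greedy_error_ge0.
  - by rewrite ltcR.
  - by rewrite ltcR.
  - apply/is_trig_mxP => i j lt_ij; rewrite mxE.
    by apply: (dot_gen_gs_gt gse); rewrite ltn_add2l.
  - move=> i; rewrite mxE (dot_gen_gs gse) sqrt_dnorm normr_id.
    apply: le_trans (greedy_error_le_max _); rewrite ler_pM2r ?invr_gt0 // lecR.
    by apply: greedy_error_decr; rewrite leq_add2l ltnW.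
  - move=> i; rewrite dotmx_sum.
    have := dnorm_residual_split gse p p (k (x (p + i)%N)).
    rewrite !rkhs_dotE => split_i.
    apply: (@le_trans _ _ (`|res p (k (x (p + i)%N))| ^+ 2)).
      rewrite split_i; under eq_bigr do rewrite !mxE.
      by rewrite lerDr exprn_ge0.
    rewrite lerXn2r ?nnegrE ?ler0c ?greedy_error_ge0 //.
    by rewrite -complex_Re_norm lecR norm_residual_le_greedy.
  (* A row annihilated by [B] is the coordinate vector of some [f] with [N f = 0], and its product
     with row [i] of [G] is a point value of [f]. *)
  move=> i c cB0; pose f : H := \sum_j c 0 j *: e (p + j)%N.
  have Nf : N f = 0.
    rewrite linear_sum -[RHS]cB0; apply/rowP => l; rewrite !mxE summxE.
    by apply: eq_bigr => j _; rewrite linearZ !mxE.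
  have -> : dotmx c (row i G) = rkhs_fun H f (x (p + i)%N).
    rewrite rkhs_reproducing dotmxE mxE linear_sumlz /=.
    apply: eq_bigr => j _; rewrite linearZl_LR /= !mxE.
    by rewrite [in RHS]hermC expr0 mul1r.
  apply: (@le_trans _ _ ((d%:C * `|f|) ^+ 2)).
    by apply: lerXn2r (N_le _ _ Nf); rewrite nnegrE // mulr_ge0 // ler0c ltW.
  rewrite exprMn ler_wpM2l ?exprn_ge0 ?ler0c ?(ltW d_gt0) //.
  rewrite dotmx_sum -rkhs_dotE.
  exact: (dnorm_comb gse).
have: ((greedy_error (p + p)) ^+ 2)%:C <= (8 * greedy_error p * d)%:C.
  rewrite rmorphXn !rmorphM /= rmorph_nat.
  move: le_sq; rewrite exprMn exprVn ler_pdivrMr ?exprn_gt0 //.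
  move=> /le_trans; apply.
  by rewrite le_eqVlt; apply/orP; left; apply/eqP; ring.
by rewrite lecR.
Qed.

End GreedyBasis.

(** The residual map is self-adjoint for any [e], which moves it from a function onto a section. *)
Lemma dot_residual_sym (e : nat -> H) n (v w : H) :
  dot (residual dot e n v) w = dot v (residual dot e n w).
Proof.
rewrite /residual linearBl linearBr /= linear_sumlz linear_sumr /=.
congr (_ - _); apply: eq_bigr => i _.
by rewrite linearZl_LR linearZr_LR /= [dot (e i) w]hermC expr0 mul1r mulrC.
Qed.

(** For a suitable [A], which turns samples into coefficients along [e], this is the orthogonal
    projection recovered from point values. *)
Definition reconstruct n (e : nat -> H) (A : 'M[C]_n) (v : 'rV[C]_n) : D -> C :=
  rkhs_fun H (\sum_i (v *m A) 0 i *: e i).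

Fact reconstruct_linear n e (A : 'M[C]_n) : linear (reconstruct e A).
Proof.
move=> a u v; rewrite /reconstruct -linearP; congr (rkhs_fun H _).
rewrite scaler_sumr -big_split /=; apply: eq_bigr => i _.
by rewrite mulmxDl -scalemxAl !mxE scalerDl scalerA.
Qed.

HB.instance Definition _ n e (A : 'M[C]_n) :=
  GRing.isLinear.Build C 'rV[C]_n (D -> C) *:%R (reconstruct e A)
    (reconstruct_linear e A).

Lemma norm_unit_le (v : H) : `| `|v|^-1 *: v | <= 1.
Proof.
rewrite normrZ normfV normr_id; have [->|v_neq0] := eqVneq v 0.
  by rewrite normr0 mulr0.
by rewrite mulVf // normr_eq0.
Qed.

Lemma sup_norm_ge (g : D -> C) y : ((complex.Re `|g y|)%:E <= sup_norm g)%E.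
Proof. by apply: ereal_sup_ubound; exists y. Qed.

Context (D_nonempty : inhabited D) (K_bounded : (kernel_radius K < +oo)%E).

Lemma bounded_rkhs_fun (f : H) : bounded_functions (rkhs_fun H f).
Proof.
have [M kM] := kernel_bound K_bounded.
apply: (@le_lt_trans _ _ (complex.Re `|f| * M)%:E); last by rewrite ltry.
apply: ge_ereal_sup => _ [y _ <-].
rewrite lee_fin -lecR rmorphM /= !complex_Re_norm.
apply: le_trans (norm_rkhs_fun_le f y) _.
by rewrite ler_wpM2l // -complex_Re_norm lecR.
Qed.

(** The normalized [f] and its negative both carry information 0, hence receive the same
    approximation [psi 0]; the triangle inequality eliminates it, even for non-linear [psi]. *)
Lemma norm_le_worst_case m (N : {linear H -> 'rV[C]_m})
    (psi : 'rV[C]_m -> D -> C) (d : R) f y :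
    (worst_case_error (fun f => psi (N f)) <= d%:E)%E -> N f = 0 ->
  `|rkhs_fun H f y| <= d%:C * `|f|.
Proof.
move=> err_le Nf0; pose h := `|f|^-1 *: f.
have err_at (g : H) : `|g| <= 1 -> N g = 0 ->
    `|rkhs_fun H g y - psi 0 y| <= d%:C.
  move=> g_le1 Ng0; rewrite -complex_Re_norm lecR -lee_fin.
  apply: le_trans err_le.
  apply: le_trans (ereal_sup_ubound _); last by exists g.
  by rewrite -Ng0; apply: (sup_norm_ge (rkhs_fun H g - psi (N g))).
have h_le1 : `|h| <= 1 := norm_unit_le f.
have Nh0 : N h = 0 by rewrite linearZ /= Nf0 scaler0.
have hy_le : `|rkhs_fun H h y| <= d%:C.
  have := lerD (err_at h h_le1 Nh0) (err_at (- h) _ _).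
  rewrite normrN linearN /= Nh0 oppr0 => /(_ h_le1 erefl).
  rewrite linearN /= => le2.
  rewrite -(@ler_pM2l _ 2) // -[2 in leLHS]normr_nat -normrM !mulr_natl.
  rewrite [X in _ <= X]mulr2n; apply: le_trans le2.
  apply: le_trans (ler_normB _ _).
  by rewrite opprD opprK opprK addrACA addNr addr0 mulr2n.
have [->|f_neq0] := eqVneq f 0; first
  by rewrite linear0 (_ : (0 : D -> C) y = 0) // !normr0 mulr0.
have fE : f = `|f| *: h by rewrite scalerA mulfV ?scale1r // normr_eq0.
rewrite {1}fE linearZ /= /GRing.scale /= normrM normr_id mulrC.
by rewrite ler_wpM2r.
Qed.

Section Greedy.
Context (x : nat -> D) (e : nat -> H) (gse : gram_schmidt dot (k \o x) e).

Local Notation res := (residual dot e).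
Local Notation sigma := (greedy_error e).

Lemma norm_residual_fun_le n (f : H) y :
  `|f| <= 1 -> complex.Re `|rkhs_fun H (res n f) y| <= sigma n.
Proof.
move=> f_le1; rewrite -lecR complex_Re_norm rkhs_reproducing dot_residual_sym.
apply: le_trans (dot_CauchySchwarz _ _) _.
apply: (@le_trans _ _ `|res n (k y)|); first by rewrite ler_piMl.
rewrite -complex_Re_norm lecR.
by rewrite (norm_residual_le_greedy D_nonempty K_bounded gse).
Qed.

(** Each [e i] lies in the span of the chosen sections, so the coefficients of [f] along [e] are
    linear in its samples, and the error is the residual of [f]. *)
Lemma lin_sampling_width_le_greedy n :
  (lin_sampling_width H n <= (sigma n)%:E)%E.
Proof.
case: n => [|n].
  apply: ge_ereal_sup => _ [f f_le1 <-]; apply: ge_ereal_sup => _ [y _ <-].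
  by rewrite lee_fin -{1}[f](residual0 e) norm_residual_fun_le.
have /fin_all_exists[a aE] : forall i : 'I_n.+1, in_span (k \o x) n.+1 (e i).
  by move=> i; apply: (gs_in_span gse).
(* The conjugate appears because [dot] is antilinear in its second argument. *)
pose A : 'M[C]_n.+1 := \matrix_(l, i) (a i l)^*.
apply: le_trans (_ : worst_case_error (fun f =>
  reconstruct e A (\row_j rkhs_fun H f (x j))) <= _)%E.
  apply: ereal_inf_lbound; exists (fun j : 'I_n.+1 => x j) => //.
  by exists (reconstruct e A) => // v; apply: bounded_rkhs_fun.
apply: ge_ereal_sup => _ [f f_le1 <-]; apply: ge_ereal_sup => _ [y _ <-].
rewrite lee_fin /reconstruct -linearB.
rewrite (_ : f - _ = res n.+1 f) ?norm_residual_fun_le //.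
congr (_ - _); apply: eq_bigr => i _; congr (_ *: _).
rewrite [in RHS]aE linear_sumr mxE; apply: eq_bigr => l _.
by rewrite linearZr_LR /= !mxE rkhs_reproducing mulrC.
Qed.

(** A normalized nonzero section takes the value [|k y|] at [y]. *)
Lemma greedy_error0_le : ((sigma 0)%:E <= ball_radius H)%E.
Proof.
have ub y : ((complex.Re `|res 0 (k y)|)%:E <= ball_radius H)%E.
  rewrite residual0; apply: le_trans (ereal_sup_ubound _); last first.
    by exists (`|k y|^-1 *: k y) => //; apply: norm_unit_le.
  apply: le_trans (sup_norm_ge _ y).
  rewrite lee_fin Re_norm_le rkhs_reproducing linearZl_LR /= rkhs_dotE.
  rewrite normrM normfV normr_id normrX normr_id.
  have [->|ky_neq0] := eqVneq `|k y| 0; first by rewrite mulr_ge0.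
  by rewrite expr2 mulKf.
move: ub; case: (ball_radius H) => [r| |] ub.
- by rewrite lee_fin; apply: greedy_error_le => // y; rewrite -lee_fin.
- by rewrite leey.
- by case: D_nonempty => y0; have := ub y0.
Qed.

Context (x_max : forall n y,
  complex.Re `|res n (k y)| <= 2 * complex.Re `|res n (k (x n))|).

(** The infimum may not be attained, so the doubling bound is used with error [d + eps]. *)
Lemma greedy_error_le_gelfand m (d : R) : (0 < m)%N -> 0 <= d ->
    (gelfand_width H m <= d%:E)%E ->
  sigma (m + m + (m + m)) ^+ 2 <= 8 * sigma (m + m) * d.
Proof.
case: m => // m _ d_ge0 width_le.
have s_ge0 : 0 <= sigma (m.+1 + m.+1) by apply: greedy_error_ge0.
have le_eps (eps : R) : 0 < eps ->
    sigma (m.+1 + m.+1 + (m.+1 + m.+1)) ^+ 2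
      <= 8 * sigma (m.+1 + m.+1) * (d + eps).
  move=> eps_gt0.
  have : (gelfand_width H m.+1 < (d + eps)%:E)%E.
    by apply: le_lt_trans width_le _; rewrite lte_fin ltrDl.
  move=> /ereal_inf_lt[_ [N _ [psi _ <-]] /ltW err_le].
  apply: (greedy_error_double D_nonempty K_bounded gse x_max (N := N)) => //.
    by rewrite ltr_wpDl.
  by move=> f y; apply: norm_le_worst_case err_le.
apply/ler_addgt0Pr => eps eps_gt0.
(* Adding 1 keeps the divisor positive even if the greedy error is 0. *)
pose t := 8 * sigma (m.+1 + m.+1) + 1.
have t_gt0 : 0 < t by rewrite ltr_wpDl // mulr_ge0.
apply: le_trans (le_eps (eps / t) _) _; first by rewrite divr_gt0.
rewrite mulrDr lerD2l mulrA ler_pdivrMr // mulrC ler_pM2l //.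
by rewrite lerDl.
Qed.

End Greedy.
End Widths.

Lemma exists_greedy (R : realType) (D : Type) (K : D -> D -> R[i])
    (H : rkhs K) :
    inhabited D -> (kernel_radius K < +oo)%E ->
  exists x e, gram_schmidt (rkhs_dot H) (rkhs_sec H \o x) e /\
    forall n y, complex.Re `|residual (rkhs_dot H) e n (rkhs_sec H y)|
      <= 2 * complex.Re `|residual (rkhs_dot H) e n (rkhs_sec H (x n))|.
Proof.
move=> D_nonempty K_bounded.
pose f (r : H -> H) y : R := complex.Re `|r (rkhs_sec H y)|.
(* The criterion is conditional on boundedness because it must be satisfiable for every [e], whereas
   residuals are known to be bounded only for a Gram-Schmidt sequence. *)
have [|x [e [gse x_max]]] := @exists_gram_schmidt _ _ (rkhs_dot H) D
    (rkhs_sec H) (fun r x =>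
      (exists M, forall y, f r y <= M) -> forall y, f r y <= 2 * f r x).
  move=> e n; set r := residual _ _ _; have [y0] := D_nonempty.
  have [[M rM]|unbounded] := pselect (exists M, forall y, f r y <= M); last
    by exists y0.
  have f_ge0 y : 0 <= f r y by rewrite -ler0c complex_Re_norm.
  by have [x x_max] := exists_half_max D_nonempty f_ge0 rM; exists x.
exists x, e; split=> // n; apply: x_max.
have [M kM] := kernel_bound H K_bounded.
exists M => y; apply: le_trans (kM y).
by rewrite /f Re_norm_le -{2}[rkhs_sec H y](residual0 e) (norm_residual_le gse).
Qed.

(** * The weighted comparison *)

Lemma weighted_induction (R : realType) (L : R -> R) (sigma : nat -> R)
    (c S : R) (n : nat) :
    (forall s, 0 <= s -> 0 < L s) ->
    (forall s t, 0 <= s -> s <= t -> L s <= L t) ->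
    (forall k, 0 <= sigma k) ->
    (forall p k, (p <= k)%N -> sigma k <= sigma p) ->
    L 3 / L 0 <= c ->
    (forall s, 1 <= s -> 8 * L (8 * s) ^+ 2 <= c * (L (2 * s) * L s)) ->
    L 0 * sigma 0%N <= S ->
    (forall m, (0 < m <= n)%N ->
       sigma (m + m + (m + m))%N ^+ 2 <= 8 * sigma (m + m)%N * (S / L m%:R)) ->
  forall k, (k <= n)%N -> L k%:R * sigma k <= c * S.
Proof.
move=> L_gt0 L_ndecr s_ge0 s_decr c_ge3 c_ge8 S_ge s_step.
have L0_gt0 := L_gt0 0 (lexx 0).
have S_ge0 : 0 <= S by apply: le_trans S_ge; rewrite mulr_ge0 // ltW.
have c_ge0 : 0 <= c.
  by apply: le_trans c_ge3; rewrite divr_ge0 // ltW // L_gt0.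
elim/ltn_ind=> k IHk le_kn.
have Lk_gt0 : 0 < L k%:R by rewrite L_gt0.
(* For [k <= 3] the quotient [k %/ 4] is 0 and gives no step; [L 3 / L 0] covers these indices. *)
have [le_k3|lt_3k] := leqP k 3.
  have Lk3 : L k%:R <= L 3 by rewrite L_ndecr // ler_nat.
  apply: (@le_trans _ _ (L 3 / L 0 * (L 0 * sigma 0%N))).
    by rewrite mulrA divfK ?gt_eqF // ler_pM ?s_decr // ltW.
  by rewrite ler_pM // ?divr_ge0 ?mulr_ge0 // ltW // L_gt0.
pose m := (k %/ 4)%N.
have m_gt0 : (0 < m)%N by rewrite divn_gt0.
have le_4mk : (m + m + (m + m) <= k)%N by rewrite /m; lia.
have lt_k8m : (k <= 8 * m)%N by rewrite /m; lia.
have Lm_gt0 : 0 < L m%:R by rewrite L_gt0.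
have L2m_gt0 : 0 < L (m + m)%:R by rewrite L_gt0.
have IH : L (m + m)%:R * sigma (m + m)%N <= c * S by apply: IHk; lia.
have step : sigma k ^+ 2 <= 8 * sigma (m + m)%N * (S / L m%:R).
  apply: le_trans (s_step m _); last lia.
  by rewrite lerXn2r ?nnegrE // s_decr.
have Lk_le : 8 * L k%:R ^+ 2 <= c * (L (m + m)%:R * L m%:R).
  have -> : (m + m)%:R = 2 * m%:R :> R by rewrite natrD mulr_natl mulr2n.
  apply: le_trans (c_ge8 m%:R _); last by rewrite ler1n.
  have Lk8 : L k%:R <= L (8 * m%:R) by rewrite -natrM L_ndecr // ler_nat.
  by rewrite ler_wpM2l //; apply: lerXn2r Lk8; rewrite nnegrE ltW // L_gt0.
(* After squaring, the step and the growth condition leave [c * S] times the weighted error at index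
   2m, which [IH] bounds by [c * S]. *)
rewrite -ler_sqr ?nnegrE ?mulr_ge0 ?(ltW Lk_gt0) // exprMn.
apply: (@le_trans _ _ (8 * L k%:R ^+ 2 * (sigma (m + m)%N * (S / L m%:R)))).
  rewrite [8 * _]mulrC -[leRHS]mulrA ler_wpM2l ?exprn_ge0 ?(ltW Lk_gt0) //.
  by rewrite mulrA.
apply: (@le_trans _ _ (c * (L (m + m)%:R * L m%:R) *
    (sigma (m + m)%N * (S / L m%:R)))).
  by rewrite ler_wpM2r // mulr_ge0 // divr_ge0 // ltW.
have -> : c * (L (m + m)%:R * L m%:R) * (sigma (m + m)%N * (S / L m%:R)) =
    c * S * (L (m + m)%:R * sigma (m + m)%N).
  by field; rewrite gt_eqF.
by rewrite [leRHS]expr2 ler_wpM2l // mulr_ge0.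
Qed.

Local Open Scope ereal_scope.

Theorem theorem2p1 (R : realType) (L : R -> R)
    (L_gt0 : forall s : R, (0 <= s)%R -> (0 < L s)%R)
    (L_ndecr : forall s t : R, (0 <= s)%R -> (s <= t)%R -> (L s <= L t)%R)
    (Lambda_fin : Lambda L < +oo)
    (D : Type) (D_nonempty : inhabited D)
    (K : D -> D -> R[i]) (H : rkhs K) (K_bounded : kernel_radius K < +oo)
    (n : nat) :
  ereal_sup [set (L k%:R)%:E * lin_sampling_width H k
              | k in [set k : nat | (k <= n)%N]]
  <= C_const L *
     ereal_sup [set (L k%:R)%:E * gelfand_width H k
                 | k in [set k : nat | (k <= n)%N]].
Proof.
set S := ereal_sup [set _ * gelfand_width H _ | _ in _].
have [x [e [gse x_max]]] := exists_greedy H D_nonempty K_bounded.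
have L0_gt0 := L_gt0 0%R (lexx 0%R).
have S_ub k : (k <= n)%N -> (L k%:R)%:E * gelfand_width H k <= S.
  by move=> le_kn; apply: ereal_sup_ubound; exists k.
have S_ge : (L 0 * greedy_error e 0)%:E <= S.
  apply: le_trans (S_ub 0%N (leq0n n)); rewrite EFinM.
  by apply: lee_wpmul2l; [rewrite lee_fin ltW|exact: greedy_error0_le].
(* The hypothesis excludes [+oo], and the value at [s = 1] excludes [-oo]. *)
have [l lE] : exists l, Lambda L = l%:E.
  have Lambda_ge s : (1 <= s)%R ->
      (L (8 * s) ^+ 2 / (L (2 * s) * L s))%:E <= Lambda L.
    move=> s_ge1; apply: ereal_sup_ubound; exists s => //=.
    by rewrite in_itv /= s_ge1.
  move: Lambda_fin (Lambda_ge 1%R (lexx _)); case: (Lambda L) => [l _ _| |//].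
    by exists l.
  by rewrite ltxx.
pose c := Num.max (L 3 / L 0)%R (8 * l)%R.
have cE : C_const L = c%:E by rewrite /C_const lE -EFinM -EFin_max.
have c_gt0 : (0 < c)%R by rewrite lt_max divr_gt0 // L_gt0.
(* An infinite right-hand side is trivial since [c > 0], and [S_ge] rules out [-oo]. *)
rewrite cE; case: S S_ub S_ge => [S| |] S_ub S_ge; first last.
- by [].
- by rewrite gt0_muley ?lte_fin // leey.
apply: ge_ereal_sup => _ [k le_kn <-].
have Lk_ge0 : 0 <= (L k%:R)%:E by rewrite lee_fin ltW // L_gt0.
apply: le_trans (lee_wpmul2l Lk_ge0
  (lin_sampling_width_le_greedy D_nonempty K_bounded gse k)) _.
rewrite -!EFinM lee_fin.
apply: (weighted_induction (n := n)) => //.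
- by move=> j; apply: greedy_error_ge0 gse _.
- by move=> p j; apply: greedy_error_decr gse _ _.
- by rewrite le_max lexx.
- move=> s s_ge1; have s_ge0 : (0 <= s)%R by apply: le_trans s_ge1.
  have LL_gt0 : (0 < L (2 * s) * L s)%R.
    by rewrite mulr_gt0 // L_gt0 // mulr_ge0.
  rewrite -ler_pdivrMr // -mulrA; apply: (@le_trans _ _ (8 * l)%R).
    rewrite ler_pM2l // -lee_fin -lE; apply: ereal_sup_ubound.
    by exists s => //=; rewrite in_itv /= s_ge1.
  by rewrite le_max lexx orbT.
- move=> m /andP[m_gt0 le_mn].
  have Lm_gt0 : (0 < L m%:R)%R by rewrite L_gt0.
  apply: (greedy_error_le_gelfand D_nonempty K_bounded gse x_max) => //.
    apply: divr_ge0; last exact: ltW.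
    apply: le_trans (_ : 0 <= L 0 * greedy_error e 0)%R _; last first.
      by rewrite -lee_fin.
    rewrite mulr_ge0 ?(ltW L0_gt0) //.
    by rewrite (greedy_error_ge0 D_nonempty K_bounded gse).
  (* Finiteness of [S] excludes an infinite width; a finite one is divided by [L m%:R > 0]. *)
  have := S_ub m le_mn; case: (gelfand_width H m) => [d| |].
  + by rewrite -EFinM !lee_fin ler_pdivlMr // mulrC.
  + by rewrite gt0_muley ?lte_fin.
  + by rewrite leNye.
Qed.
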